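(* Let $p_0(x),p_1(x),\dots$ be a sequence of polynomials in $\mathbf{k}[x]$ with $p_1(x)=x$ and $p_n(x)$ of degree $n$. The sequence is of binomial type if and only if there exists an umbra $\mu$ such that for all $n\ge0$ \[ p_n(x)\simeq x(x+\mu_1)(x+\mu_1+\mu_2)\cdots(x+\mu_1+\cdots+\mu_{n-1}), \] where $\mu_1,\dots,\mu_{n-1}$ are distinct umbrae each exchangeable with $\mu$ (the product being $1$ for $n=0$).
   Context: Let $\mathbf{k}$ be a commutative ring containing $\mathbb{Q}$ and $\mathbf{F}=\mathbf{k}[x,y]$. A sequence $p_0(x),p_1(x),\dots$ with $\deg p_n=n$ is of binomial type if $p_k(x+y)=\sum_i\binom{k}{i}p_i(x)p_{k-i}(y)$ for all $k$. Umbrae are formal symbols; $\mathbf{F}[\mathcal{A}]$ is the polynomial ring in the umbrae, with an $\mathbf{F}$-linear evaluation map $\mathbf{E}:\mathbf{F}[\mathcal{A}]\to\mathbf{F}$ satisfying $\mathbf{E}[1]=1$ and $\mathbf{E}[MM']=\mathbf{E}[M]\mathbf{E}[M']$ for monomials with no umbra in common (so distinct umbrae behave as independent); every sequence $1,a_1,a_2,\dots$ in $\mathbf{F}$ is represented by infinitely many umbrae. Write $p\simeq q$ if $\mathbf{E}[p]=\mathbf{E}[q]$, and $\mu_i$ is exchangeable with $\mu$ if $\mathbf{E}[\mu_i^k]=\mathbf{E}[\mu^k]$ for all $k$.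
   Formalization: The umbra μ is required to have all its moments E[μ^n] in k, not merely in k[x,y]; otherwise the ''if'' direction fails (E[μ^n]=x^n gives p_n=n!x^n, which is not of binomial type). *)

(* Defs.v *)
From HB Require Import structures.
From mathcomp Require Export all_boot all_order all_algebra.
From mathcomp Require Export finmap.
From mathcomp.multinomials Require Export monalg.

Set Implicit Arguments.
Unset Strict Implicit.
Unset Printing Implicit Defensive.

Export GRing.Theory.

Local Open Scope ring_scope.

(* Bivariate polynomials follow polyXY: in k[x, y] = {poly {poly k}}, x is 'X,
   y is 'Y, and a univariate p gives p(x) = p^:P, p(y) = p%:P and
   p(x + y) = poly_XaY p. *)
Definition binomial_type (k : comNzRingType) (p : nat -> {poly k}) : Prop :=
  (forall n, size (p n) = n.+1) /\
  forall n, poly_XaY (p n) =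
    \sum_(i < n.+1) ((p i)^:P * (p (n - i)%N)%:P) *+ 'C(n, i).

(* F[A], the polynomial ring over F = k[x, y] in the possibly infinite alphabet
   A of umbrae: the algebra of the free commutative monoid {cmonom A}. *)
Notation umbral_poly k A := {malg {poly {poly k}}[{cmonom A}]}.

Section Umbrae.
Variables (k : comNzRingType) (A : choiceType).
Local Notation F := {poly {poly k}}.

Definition umbra (a : A) : umbral_poly k A := << ucm a >>.

Variable E : {scalar umbral_poly k A}.

Definition represents (a : A) (f : nat -> F) : Prop :=
  forall n, E (umbra a ^+ n) = f n.

Record umbral_evaluation : Prop := UmbralEvaluation {
  umbral_eval1 : E 1 = 1;
  umbral_evalM : forall m1 m2 : {cmonom A},
    [disjoint finsupp m1 & finsupp m2]%fset ->
    E (<< m1 >> * << m2 >>) = E << m1 >> * E << m2 >>;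
  (* infinitely many: no finite list of umbrae exhausts the representatives *)
  umbral_saturated : forall f : nat -> F, f 0%N = 1 ->
    forall s : seq A, exists2 a, a \notin s & represents a f
}.

Definition umbral_eq (q r : umbral_poly k A) : Prop := E q = E r.

Definition exchangeable (a b : A) : Prop :=
  forall n, umbral_eq (umbra a ^+ n) (umbra b ^+ n).

(* The moments lie in k, not merely in k[x, y]. An umbra with moments 'X^n
   would turn x(x + mu_1)...(x + mu_1 + ... + mu_{n-1}) into n! x^n, which is
   not of binomial type. *)
Definition scalar_umbra (a : A) : Prop :=
  exists m : nat -> k, represents a (fun n => (m n)%:P%:P).

End Umbrae.

(* Main.v *)
From HB Require Import structures.
Require Import Defs.
From mathcomp Require Import ring.

(* Let [T f = E[f(x + mu)] = sum_l m_l f^(l) / l!], with [m] the moments of [mu].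
   Evaluating the umbra [mu_1] last shows that the product evaluates to
   [q_n = (xT)^n 1].  Writing [f^s = f(x + y)], shift invariance of [T] gives
   [(xTf)^s = (x T_x + y T_y) f^s], so the binomial theorem for the commuting
   operators [x T_x] and [y T_y] makes [q] of binomial type; this is carried out
   on coefficients.  Conversely, a sequence of binomial type is determined by its
   linear coefficients [p_n'(0)], and since [p_n] is monic the triangular system
   [(T p_n)(0) = p_(n+1)'(0)] can be solved for the moments of [mu]. *)

Set Implicit Arguments.
Unset Strict Implicit.
Unset Printing Implicit Defensive.

Local Open Scope ring_scope.

(** * Taylor expansion and binomial coefficient identities *)

Lemma comp_poly_XaddC_taylor (R : comNzRingType) (p : {poly R}) (c : R) n :
  (size p <= n)%N -> p \Po ('X + c%:P) = \sum_(l < n) c ^+ l *: p^`N(l).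
Proof.
move=> le_pn; rewrite /comp_poly (@nderiv_taylor_wide _ n); first last.
- by rewrite size_map_polyC.
- exact: mulrC.
apply: eq_bigr => l _; rewrite nderivn_map -[_.['X]]/(_ \Po 'X) comp_polyXr.
by rewrite -rmorphXn mulrC mul_polyC.
Qed.

Lemma bin_addC a b : 'C(a + b, a) = 'C(a + b, b).
Proof. by rewrite -(bin_sub (leq_addl a b)) addnK. Qed.

(** Both sides are the trinomial coefficient [(l + a + b)! / (l! a! b!)]. *)
Lemma trinomial_swap a b l :
  ('C(a + b, b) * 'C(l + (a + b), l) = 'C(l + a, l) * 'C(l + a + b, b))%N.
Proof.
have f_gt0 : (0 < l`! * a`! * b`!)%N by rewrite !muln_gt0 !fact_gt0.
apply/eqP; rewrite -(eqn_pmul2r f_gt0); apply/eqP.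
have e1 := bin_fact (leq_addl a b); rewrite addnK in e1.
have e2 := bin_fact (leq_addr (a + b) l); rewrite addKn in e2.
have e3 := bin_fact (leq_addr a l); rewrite addKn in e3.
have e4 := bin_fact (leq_addl (l + a) b); rewrite addnK in e4.
transitivity ('C(l + (a + b), l) * (l`! * ('C(a + b, b) * (b`! * a`!))))%N.
  by ring.
by rewrite e1 e2 addnA -e4 -e3; ring.
Qed.

Lemma sum_bin_pascal (V : nmodType) (f : nat -> nat -> V) n :
  \sum_(i < n.+2) f i (n.+1 - i)%N *+ 'C(n.+1, i) =
  \sum_(i < n.+1) f i.+1 (n - i)%N *+ 'C(n, i)
  + \sum_(i < n.+1) f i (n - i).+1 *+ 'C(n, i).
Proof.
have -> : \sum_(i < n.+1) f i (n - i).+1 *+ 'C(n, i) =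
    \sum_(i < n.+2) f i (n.+1 - i)%N *+ 'C(n, i).
  rewrite [RHS]big_ord_recr /= bin_small // mulr0n addr0.
  by apply: eq_bigr => i _; rewrite subSn // -ltnS.
rewrite big_ord_recl [X in _ = _ + X]big_ord_recl /= !bin0 addrCA.
congr (_ + _); rewrite -big_split /=.
by apply: eq_bigr => i _; rewrite /bump /= add1n subSS binS mulrnDr addrC.
Qed.

Lemma sum_bin_rev (V : nmodType) (f : nat -> nat -> V) n :
  \sum_(i < n.+1) f i (n - i)%N *+ 'C(n, i) =
  \sum_(i < n.+1) f (n - i)%N i *+ 'C(n, i).
Proof.
rewrite (reindex_inj rev_ord_inj) /=; apply: eq_bigr => i _.
have le_in : (i <= n)%N by rewrite -ltnS.
by rewrite subSS subKn // bin_sub.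
Qed.

(** * Binomial type in terms of coefficients *)

Lemma coef_poly_XaY (R : comNzRingType) (p : {poly R}) a b :
  (poly_XaY p)`_a`_b = p`_(a + b) *+ 'C(a + b, a).
Proof.
pose n := maxn (size p) b.+1.
rewrite /poly_XaY (@comp_poly_XaddC_taylor _ _ _ n); last first.
  by rewrite size_map_polyC leq_maxl.
rewrite !coef_sum (bigD1 (Ordinal (leq_maxr (size p) b.+1))) //= big1.
  rewrite addr0 coefZ nderivn_map coef_map /= coefMC coefXn eqxx mul1r.
  by rewrite coef_nderivn addnC -(bin_sub (leq_addl _ _)) addnK.
move=> l; rewrite -val_eqE /= => lb.
by rewrite coefZ nderivn_map coef_map /= coefMC coefXn eq_sym (negPf lb) mul0r.
Qed.

(** Coefficients of [x^a y^b] are compared. The degree condition is kept apart because the degree of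
    [umbral_seq m n] can drop for arbitrary [m]. *)
Definition binomial_coefs (R : comNzRingType) (p : nat -> {poly R}) : Prop :=
  forall n a b, (p n)`_(a + b) *+ 'C(a + b, a) =
    \sum_(i < n.+1) ((p i)`_a * (p (n - i)%N)`_b) *+ 'C(n, i).

Lemma binomial_typeP (R : comNzRingType) (p : nat -> {poly R}) :
  (forall n, size (p n) = n.+1) -> binomial_type p <-> binomial_coefs p.
Proof.
move=> szp.
have cR n a b : (\sum_(i < n.+1)
     ((p i)^:P * (p (n - i)%N)%:P) *+ 'C(n, i))`_a`_b =
    \sum_(i < n.+1) ((p i)`_a * (p (n - i)%N)`_b) *+ 'C(n, i).
  rewrite !coef_sum; apply: eq_bigr => i _.
  by rewrite !coefMn coefMC coef_map /= coefCM.
split=> [[_ bp] n a b|bp]; first by rewrite -coef_poly_XaY bp cR.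
by split=> // n; apply/polyP => a; apply/polyP => b; rewrite coef_poly_XaY cR bp.
Qed.

(** * The shift operator and the binomial sequence it generates *)

Section ShiftOperator.
Variables (R : comNzRingType) (m : nat -> R).

(* [f |-> E[f(x + mu)]], where [m] is the moment sequence of [mu]. *)
Definition umbral_shift (f : {poly R}) : {poly R} :=
  \sum_(l < size f) m l *: f^`N(l).

Lemma coef_umbral_shift (f : {poly R}) n a : (size f <= n)%N ->
  (umbral_shift f)`_a = \sum_(l < n) m l * (f`_(l + a) *+ 'C(l + a, l)).
Proof.
move=> le_fn; rewrite coef_sum.
rewrite (big_ord_widen _ (fun l => (m l *: f^`N(l))`_a) le_fn).
rewrite big_mkcond /=; apply: eq_bigr => l _; rewrite coefZ coef_nderivn.
case: ltnP => // le_fl.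
by rewrite nth_default ?mul0rn ?mulr0 // (leq_trans le_fl) ?leq_addr.
Qed.

Lemma size_umbral_shift f : (size (umbral_shift f) <= size f)%N.
Proof.
apply/leq_sizeP => j le_fj; rewrite (coef_umbral_shift _ (leqnn _)) big1 // => l _.
by rewrite nth_default ?mul0rn ?mulr0 // (leq_trans le_fj) ?leq_addl.
Qed.

Fixpoint umbral_seq n : {poly R} :=
  if n is n'.+1 then 'X * umbral_shift (umbral_seq n') else 1.

Lemma size_umbral_seq n : (size (umbral_seq n) <= n.+1)%N.
Proof.
elim: n => [|n IHn] /=; first by rewrite size_poly1.
apply: leq_trans (size_polyMleq _ _) _; rewrite size_polyX /=.
exact: leq_ltn_trans (size_umbral_shift _) _.
Qed.

Lemma umbral_seqS0 n : (umbral_seq n.+1)`_0 = 0.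
Proof. by rewrite /= coefXM. Qed.

(** The bound [N] is free so that the expansions for all indices up to [n] can share one range of
    summation. *)
Lemma umbral_seqSS n N a : (n < N)%N -> (umbral_seq n.+1)`_a.+1 =
  \sum_(l < N) m l * ((umbral_seq n)`_(l + a) *+ 'C(l + a, l)).
Proof.
move=> ltnN; rewrite /= coefXM /=; apply: coef_umbral_shift.
exact: leq_trans (size_umbral_seq n) ltnN.
Qed.

(** This is [x T_x] applied to the identity at [n]. After expansion in the moments, [trinomial_swap]
    lets the hypothesis act at [c = l + a], and summing over [l] first rebuilds the coefficients of
    [umbral_seq i.+1]. *)
Lemma umbral_seq_binomial_step n a b :
    (forall c, (umbral_seq n)`_(c + b) *+ 'C(c + b, c) = \sum_(i < n.+1)
      ((umbral_seq i)`_c * (umbral_seq (n - i)%N)`_b) *+ 'C(n, i)) ->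
  (umbral_seq n.+1)`_(a.+1 + b) *+ 'C(a + b, b) = \sum_(i < n.+1)
    ((umbral_seq i.+1)`_a.+1 * (umbral_seq (n - i)%N)`_b) *+ 'C(n, i).
Proof.
move=> IHn; rewrite addSn (umbral_seqSS _ (ltnSn n)) -sumrMnl.
transitivity (\sum_(l < n.+1) \sum_(i < n.+1)
    (m l * ((umbral_seq i)`_(l + a) *+ 'C(l + a, l)) * (umbral_seq (n - i)%N)`_b)
      *+ 'C(n, i)).
  apply: eq_bigr => l _; rewrite -mulrnAr -mulrnA mulnC trinomial_swap.
  rewrite mulnC mulrnA addnA -bin_addC IHn -sumrMnl mulr_sumr.
  by apply: eq_bigr => i _; rewrite mulrnAC -[in LHS]mulrnAl [LHS]mulrnAr mulrA.
rewrite exchange_big; apply: eq_bigr => i _ /=.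
by rewrite (umbral_seqSS _ (ltn_ord i)) mulr_suml -sumrMnl.
Qed.

(* Pascal's rule on [n] splits the right-hand side into the contributions of
   [x T_x] and [y T_y]; Pascal's rule on [a + b] splits the left-hand side
   accordingly. *)
Lemma umbral_seq_binomial : binomial_coefs umbral_seq.
Proof.
elim=> [|n IHn] a b.
  rewrite big_ord1 bin0 mulr1n subn0 /= !coef1.
  by case: a b => [|a] [|b]; rewrite ?addn0 ?add0n ?bin0 ?binn ?mulr1n ?mul1r
     ?mulr1 ?mul0r ?mul0rn.
rewrite (sum_bin_pascal (fun i j => (umbral_seq i)`_a * (umbral_seq j)`_b)).
have sL : \sum_(i < n.+1) ((umbral_seq i.+1)`_a * (umbral_seq (n - i)%N)`_b)
    *+ 'C(n, i) =
    if a is a'.+1 then (umbral_seq n.+1)`_(a + b) *+ 'C(a' + b, b) else 0.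
  case: a => [|a]; last by rewrite (umbral_seq_binomial_step _ (fun c => IHn c b)).
  by rewrite big1 // => i _; rewrite umbral_seqS0 mul0r mul0rn.
have sR : \sum_(i < n.+1) ((umbral_seq i)`_a * (umbral_seq (n - i).+1)`_b)
    *+ 'C(n, i) =
    if b is b'.+1 then (umbral_seq n.+1)`_(a + b) *+ 'C(a + b', a) else 0.
  case: b {sL} => [|b].
    by rewrite big1 // => i _; rewrite umbral_seqS0 mulr0 mul0rn.
  (* The contribution of [y T_y] is that of [x T_x] with the two variables exchanged: reverse the
     sum and commute each product. *)
  rewrite (sum_bin_rev (fun i j => (umbral_seq i)`_a * (umbral_seq j.+1)`_b.+1)).
  under eq_bigr do rewrite mulrC.
  rewrite -umbral_seq_binomial_step; first by rewrite addnC [(b + a)%N]addnC.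
  move=> c; rewrite addnC -bin_addC IHn.
  rewrite (sum_bin_rev (fun i j => (umbral_seq i)`_a * (umbral_seq j)`_c)).
  by under eq_bigr do rewrite mulrC.
rewrite {}sL {}sR; case: a b => [|a] [|b].
- by rewrite umbral_seqS0 mul0rn addr0.
- by rewrite add0r !bin0.
- by rewrite addr0 addn0 binn bin0.
rewrite -mulrnDr addnS addSn binS addnS -addSn; congr (_ *+ _).
by rewrite addnC addSnnS bin_addC.
Qed.

End ShiftOperator.

(** * Rigidity of binomial sequences, by cancelling positive integers in [k] *)

Lemma mulrIn_ratAlg (k : comAlgType rat) n (x y : k) :
  x *+ n.+1 = y *+ n.+1 -> x = y.
Proof.
rewrite -!scaler_nat => /(congr1 (fun z => (n.+1%:R : rat)^-1 *: z)).
by rewrite !scalerA mulVf ?scale1r // Num.Theory.pnatr_eq0.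
Qed.

Section BinomialCoefs.
Variables (k : comAlgType rat) (p : nat -> {poly k}).
Hypotheses (bp : binomial_coefs p) (p1 : p 1%N = 'X).
Hypothesis szp : forall n, size (p n) = n.+1.

(** [p 0] is a constant, and the coefficient of [x] in [p_1(x + y)] shows that it is 1. *)
Lemma binomial_coefs0 : p 0%N = 1.
Proof.
rewrite [LHS]size1_polyC ?szp //; have := bp 1 1 0.
rewrite addn0 binn mulr1n !big_ord_recl big_ord0 /= p1 !coefX /= mulr0 mul0rn.
by rewrite add0r mul1r addr0 -[bump 0 0]/1%N subnn binn !mulr1n => <-.
Qed.

(** At [x = y = 0] the middle terms vanish by induction, and the two end terms leave [c = c + c] for
    the constant term [c]. *)
Lemma binomial_coefsS0 n : (p n.+1)`_0 = 0.
Proof.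
elim/ltn_ind: n => n IHn; have := bp n.+1 0 0.
rewrite addn0 bin0 mulr1n big_ord_recl big_ord_recr /= big1; last first.
  by move=> i _; rewrite /bump /= add1n IHn // mul0r mul0rn.
rewrite /bump /= add1n subnn binn bin0 !mulr1n binomial_coefs0 coef1 mul1r mulr1.
by rewrite add0r => /eqP; rewrite -{1}[(p _)`_0]addr0 (inj_eq (addrI _)) eq_sym => /eqP.
Qed.

(** In the coefficient of [x^n y] in [p_(n+1)(x + y)] only the term [i = n] survives, so [n + 1]
    times the leading coefficient of [p_(n+1)] is [n + 1] times that of [p_n]. *)
Lemma binomial_coefs_monic n : (p n)`_n = 1.
Proof.
elim: n => [|n IHn]; first by rewrite binomial_coefs0 coef1.
apply: (@mulrIn_ratAlg _ n); have := bp n.+1 n 1.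
rewrite addn1 binSn => ->; rewrite !big_ord_recr big1 /=; last first.
  by move=> i _; rewrite nth_default ?mul0r ?mul0rn // szp.
rewrite subnn binomial_coefs0 coef1 mulr0 mul0rn addr0 add0r binSn.
by rewrite subSnn p1 coefX mulr1 IHn.
Qed.

End BinomialCoefs.

(** The coefficient of [x^a y] expresses [(a + 1) (p n.+1)_(a+1)] through earlier polynomials and
    linear coefficients. The last hypothesis is conditional because the linear coefficient of
    [umbral_seq m n.+1] is computed from [umbral_seq m n]. *)
Lemma binomial_coefs_inj (k : comAlgType rat) (p q : nat -> {poly k}) :
    binomial_coefs p -> binomial_coefs q -> p 0%N = 1 -> q 0%N = 1 ->
    (forall n, (p n.+1)`_0 = 0) -> (forall n, (q n.+1)`_0 = 0) ->
    (forall n, p n = q n -> (p n.+1)`_1 = (q n.+1)`_1) ->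
  p =1 q.
Proof.
move=> bp bq p0 q0 pS0 qS0 e1; elim/ltn_ind=> -[|n] IHn; first by rewrite p0 q0.
have e1n i : (i <= n)%N -> (p i.+1)`_1 = (q i.+1)`_1.
  by move=> le_in; apply: e1; apply: IHn.
apply/polyP => -[|a]; first by rewrite pS0 qS0.
apply: (@mulrIn_ratAlg _ a); have := bp n.+1 a 1; have := bq n.+1 a 1.
rewrite !addn1 !binSn => -> ->.
rewrite big_ord_recr [RHS]big_ord_recr /= subnn p0 q0.
rewrite !coef1 !mulr0 mul0rn !addr0.
apply: eq_bigr => i _; have le_in : (i <= n)%N by rewrite -ltnS.
by rewrite (IHn _ (ltn_ord i)) (subSn le_in) e1n ?leq_subr.
Qed.

Lemma triangular_solve (R : nzRingType) (a : nat -> nat -> R) (c : nat -> R) :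
    (forall n, a n n = 1) ->
  exists m : nat -> R, forall n, \sum_(l < n.+1) a n l * m l = c n.
Proof.
move=> a1.
(* Forward substitution: [next] solves row [size s] for its last unknown, given the list [s] of all
   previous ones. *)
pose next (s : seq R) := c (size s) - \sum_(l < size s) a (size s) l * s`_l.
pose ms := fix ms n := if n is n'.+1 then rcons (ms n') (next (ms n')) else [::].
have sz n : size (ms n) = n by elim: n => //= n IHn; rewrite size_rcons IHn.
have msE n l : (l < n)%N -> (ms n)`_l = next (ms l).
  elim: n => // n IHn; rewrite ltnS leq_eqVlt nth_rcons sz.
  by case/predU1P=> [->|ltln]; rewrite ?ltnn ?eqxx // ltln IHn.
exists (fun l => next (ms l)) => n; rewrite big_ord_recr /= a1 mul1r.
under eq_bigr => l _ do rewrite -(msE n) //.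
by rewrite /next sz addrC subrK.
Qed.

(** * The umbral product as a polynomial *)

Section UmbralFactorial.
Variable R : comNzRingType.
Implicit Types (u : nat -> R) (n : nat).

(* [X(X + u_1)...(X + u_1 + ... + u_(n-1))]; keeping [X] a variable over
   [R = F[A]] lets the umbrae be evaluated coefficientwise. *)
Definition umbral_factorial u n : {poly R} :=
  \prod_(0 <= i < n) ('X + (\sum_(1 <= j < i.+1) u j)%:P).

Lemma umbral_factorial0 u : umbral_factorial u 0 = 1.
Proof. by rewrite /umbral_factorial big_geq. Qed.

(** Every factor but the first contains [u 1], which is absorbed into the variable. *)
Lemma umbral_factorialS u n : umbral_factorial u n.+1 =
  'X * (umbral_factorial (u \o S) n \Po ('X + (u 1%N)%:P)).
Proof.
rewrite /umbral_factorial big_nat_recl // [X in X%:P]big_geq // polyC0 addr0.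
congr (_ * _).
rewrite rmorph_prod /=; apply: eq_bigr => i _.
rewrite comp_polyD comp_polyX comp_polyC -addrA -polyCD; congr (_ + _%:P).
by rewrite big_nat_recl.
Qed.

Lemma size_umbral_factorial u n : (size (umbral_factorial u n) <= n.+1)%N.
Proof.
elim: n u => [|n IHn] u; first by rewrite umbral_factorial0 size_poly1.
rewrite umbral_factorialS; apply: leq_trans (size_polyMleq _ _) _.
rewrite size_polyX /= ltnS; apply: leq_trans (size_comp_poly_leq _ _) _.
by rewrite size_XaddC muln1; have := IHn (u \o S); case: (size _).
Qed.

Lemma horner_umbral_factorial u n x : (umbral_factorial u n).[x] =
  \prod_(0 <= i < n) (x + \sum_(1 <= j < i.+1) u j).
Proof. by rewrite horner_prod; apply: eq_bigr => i _; rewrite hornerD hornerX hornerC. Qed.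

End UmbralFactorial.

(** * Polynomials not involving a given umbra *)

Section UmbraFree.
Variables (R : comNzRingType) (A : choiceType).
Local Notation U := {malg R[{cmonom A}]}.

Lemma malgU1M (m1 m2 : {cmonom A}) :
  << m1 >> * << m2 >> = << mmul m1 m2 >> :> U.
Proof. by rewrite malgM_def fgmulUU mulr1. Qed.

Lemma malgUE (c : R) (m : {cmonom A}) : << c *g m >> = c *: << m >> :> U.
Proof. by rewrite -mul_malgC malgM_def fgmulUU mulr1 mul1m. Qed.

Definition umbra_free (a : A) : {pred U} :=
  fun g => all (fun m : {cmonom A} => m a == 0%N) (msupp g).

Lemma umbra_freeP a (g : U) :
  reflect (forall m, m \in msupp g -> m a = 0%N) (g \in umbra_free a).
Proof. by apply: (iffP allP) => h m /h /eqP. Qed.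

Fact umbra_free_subring a : subring_closed (umbra_free a).
Proof.
split=> [|g h /umbra_freeP fg /umbra_freeP fh|g h /umbra_freeP fg /umbra_freeP fh].
- apply/umbra_freeP => m; rewrite -mcoeff_neq0 mcoeff1.
  by have [->|_] := eqVneq m mone; rewrite ?cm1 ?eqxx.
- apply/umbra_freeP => m /(fsubsetP (msuppB_le _ _)).
  by rewrite inE => /orP[/fg|/fh].
apply/umbra_freeP => m /msuppM_le [m1 [m2 [/fg e1 /fh e2 ->]]].
by rewrite cmM e1 e2.
Qed.
HB.instance Definition _ a :=
  GRing.isSubringClosed.Build U (umbra_free a) (umbra_free_subring a).

Lemma umbra_free_ucm a b : a != b -> (<< ucm b >> : U) \in umbra_free a.
Proof.
move=> ab; apply/umbra_freeP => m; rewrite -mcoeff_neq0 mcoeffU1.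
have [<- _|_] := eqVneq (ucm b) m; last by rewrite eqxx.
by rewrite cmU eq_sym (negPf ab).
Qed.

End UmbraFree.
Arguments umbra_free {R A} a.

(** * Independence and evaluation of the umbral product *)

Section UmbralIndependence.
Variables (k : comNzRingType) (A : choiceType).
Local Notation U := (umbral_poly k A).

Lemma umbraX a n : exists2 m : {cmonom A},
  umbra k a ^+ n = << m >> & forall b, b != a -> m b = 0%N.
Proof.
elim: n => [|n [m e m0]]; first by exists mone => // b _; rewrite cm1.
exists (mmul (ucm a) m); first by rewrite exprS e; apply: malgU1M.
by move=> b ba; rewrite cmM cmU m0 // eq_sym (negPf ba).
Qed.

Variables (E : {scalar U}) (HE : umbral_evaluation E).

(** Multiplicativity is given on monomials only; it extends to [g] by linearity, as no monomial of
    [g] meets the power of [a]. *)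
Lemma umbral_evalXM a n g : g \in umbra_free a ->
  E (umbra k a ^+ n * g) = E (umbra k a ^+ n) * E g.
Proof.
move=> /umbra_freeP fg; have [m -> m0] := umbraX a n.
rewrite (monalgE g) mulr_sumr !linear_sum mulr_sumr /=.
rewrite big_seq [RHS]big_seq; apply: eq_bigr => m' /fg m'a.
rewrite (malgUE _ m') -scalerAr [LHS]linearZ [in RHS]linearZ /=.
rewrite (umbral_evalM HE); first exact: mulrCA.
apply/fdisjointP => b; rewrite -!cmE_neq0; case: (eqVneq b a) => [->|/m0 ->//].
by rewrite m'a.
Qed.

Lemma umbral_evalC c : E c%:MP = c.
Proof.
by rewrite -[c%:MP]mulr1 mul_malgC linearZ /= (umbral_eval1 HE) mulr1.
Qed.

Lemma scalar_umbra_moment0 a (m : nat -> k) :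
  represents E a (fun n => (m n)%:P%:P) -> m 0%N = 1.
Proof.
by move=> /(_ 0%N); rewrite expr0 (umbral_eval1 HE) => /esym/polyC_inj/polyC_inj.
Qed.

Lemma umbra_free_factorial a nu n : (forall i, (1 <= i < n)%N -> a != nu i) ->
  umbral_factorial (@umbra k A \o nu) n \is a polyOver (umbra_free a).
Proof.
move=> a_nu; rewrite /umbral_factorial big_nat; apply: rpred_prod => i /= lt_in.
apply: rpredD; rewrite ?polyOverX // polyOverC big_nat.
apply: rpred_sum => j /andP[j1 lt_ji].
by apply: umbra_free_ucm; rewrite a_nu // j1 (leq_trans lt_ji).
Qed.

(* Peeling off [nu_1], which is independent of the remaining umbrae, gives the
   recursion defining [umbral_seq]. *)
Lemma umbral_eval_factorial (m : nat -> k) nu n a : m 0%N = 1 ->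
    {in [pred i | (1 <= i < n)%N] &, injective nu} ->
    (forall i, (1 <= i < n)%N -> represents E (nu i) (fun l => (m l)%:P%:P)) ->
  E (umbral_factorial (@umbra k A \o nu) n)`_a = ((umbral_seq m n)`_a)%:P%:P.
Proof.
move=> m0; elim: n nu a => [|n IHn] nu a nu_inj nu_m.
  rewrite umbral_factorial0 !coef1.
  by case: eqP => _; rewrite ?(umbral_eval1 HE) ?linear0.
case: a => [|a]; first by rewrite umbral_seqS0 umbral_factorialS coefXM linear0.
(* For a single factor the hypotheses say nothing about [nu 1], so it cannot be peeled off; here
   [m 0 = 1] gives the result directly. *)
case: n => [|n] in IHn nu_inj nu_m *.
  rewrite (umbral_seqSS _ _ (ltnSn _)) big_ord1 m0 bin0 mulr1n mul1r /=.
  rewrite umbral_factorialS coefXM umbral_factorial0 comp_polyC !coef1 /=.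
  by case: (a == 0%N); rewrite ?(umbral_eval1 HE) ?linear0.
have nu'_free : umbral_factorial (@umbra k A \o (nu \o S)) n.+1
    \is a polyOver (umbra_free (nu 1%N)).
  apply: umbra_free_factorial => i /andP[i1 lt_in].
  by rewrite (inj_in_eq nu_inj) ?inE //= eqSS eq_sym -lt0n.
rewrite (umbral_seqSS _ _ (ltnSn _)) umbral_factorialS coefXM /=.
(* Expand in powers of [nu 1]: each power multiplies a divided derivative free of [nu 1], so its
   evaluation contributes the factor [m l]. *)
rewrite (comp_poly_XaddC_taylor _ (size_umbral_factorial _ _)) coef_sum.
rewrite linear_sum rmorph_sum rmorph_sum /=; apply: eq_bigr => l _.
rewrite coefZ umbral_evalXM; last by rewrite coef_nderivn rpredMn // (polyOverP _).
rewrite coef_nderivn linearMn /= nu_m // IHn.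
- by rewrite !rmorphM !rmorphMn.
- move=> i j /andP[_ i_n] /andP[_ j_n] /= /nu_inj e.
  by apply: succn_inj; apply: e.
by move=> i /andP[_ lt_in]; apply: nu_m.
Qed.

Lemma umbral_eval_umbral_seq (m : nat -> k) nu n : m 0%N = 1 ->
    {in [pred i | (1 <= i < n)%N] &, injective nu} ->
    (forall i, (1 <= i < n)%N -> represents E (nu i) (fun l => (m l)%:P%:P)) ->
  E (\prod_(0 <= i < n) ('X%:MP + \sum_(1 <= j < i.+1) umbra k (nu j))) =
  (umbral_seq m n)^:P.
Proof.
move=> m0 nu_inj nu_m.
rewrite -(horner_umbral_factorial (@umbra k A \o nu)).
rewrite (horner_coef_wide _ (size_umbral_factorial (@umbra k A \o nu) n)) linear_sum /=.
have sz : (size (umbral_seq m n)^:P <= n.+1)%N.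
  by rewrite size_map_polyC size_umbral_seq.
rewrite -[RHS]comp_polyXr /comp_poly (horner_coef_wide _ (n := n.+1)); last first.
  by rewrite size_map_polyC.
apply: eq_bigr => i _; rewrite mulrC -rmorphXn mul_malgC linearZ /=.
by rewrite (umbral_eval_factorial _ m0) // !coef_map /= mulrC.
Qed.

(** Saturation, applied to the moments of [mu], supplies each time an umbra outside the list chosen
    so far. *)
Lemma exchangeable_umbrae mu n : exists nu : nat -> A,
  {in [pred i | (1 <= i < n)%N] &, injective nu} /\
  forall i, (1 <= i < n)%N -> exchangeable E (nu i) mu.
Proof.
have [s [sz_s uniq_s s_mu]] : exists s : seq A,
    [/\ size s = n, uniq s & {in s, forall a, exchangeable E a mu}].
  elim: n => [|n [s [sz_s uniq_s s_mu]]]; first by exists [::].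
  have [|a a_s a_mu] := umbral_saturated HE (f := fun i => E (umbra k mu ^+ i)) _ s.
    by rewrite expr0 (umbral_eval1 HE).
  exists (a :: s); split; first by rewrite /= sz_s.
    by rewrite /= a_s.
  move=> b; rewrite inE => /predU1P[->|b_s]; first exact: a_mu.
  exact: s_mu.
exists (nth mu s); split=> [i j|i].
  rewrite !inE => /andP[_ lt_in] /andP[_ lt_jn] /eqP.
  by rewrite nth_uniq ?sz_s // => /eqP.
by case/andP=> _ lt_in; apply: s_mu; rewrite mem_nth ?sz_s.
Qed.

End UmbralIndependence.

Theorem theorem5p8 (k : comAlgType rat) (A : choiceType)
    (E : {scalar umbral_poly k A}) (HE : umbral_evaluation E)
    (p : nat -> {poly k}) (p1 : p 1%N = 'X)
    (deg_p : forall n, size (p n) = n.+1) :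
  binomial_type p <->
  exists2 mu : A, scalar_umbra E mu &
    forall (n : nat) (nu : nat -> A),
      {in [pred i | (1 <= i < n)%N] &, injective nu} ->
      (forall i, (1 <= i < n)%N -> exchangeable E (nu i) mu) ->
      umbral_eq E ((p n)^:P)%:MP
        (\prod_(0 <= i < n) ('X%:MP + \sum_(1 <= j < i.+1) umbra k (nu j))).
Proof.
rewrite (binomial_typeP deg_p); split=> [bp | [mu [m mu_m] p_mu]].
- have [m p_m] := triangular_solve (fun n => (p n.+1)`_1)
    (binomial_coefs_monic bp p1 deg_p : forall n, (fun n l => (p n)`_l) n n = 1).
  have m0 : m 0%N = 1.
    have := p_m 0%N; rewrite big_ord1 (binomial_coefs0 bp p1 deg_p) coef1 mul1r.
    by rewrite p1 coefX.
  have p_q : p =1 umbral_seq m.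
    apply: (binomial_coefs_inj bp (umbral_seq_binomial m)) => //.
    + exact: (binomial_coefs0 bp p1 deg_p).
    + exact: (binomial_coefsS0 bp p1 deg_p).
    + exact: umbral_seqS0.
    (* At [a = 0] the recursion is exactly row [n] of the triangular system solved by [m]. *)
    move=> n e; rewrite (umbral_seqSS _ _ (ltnSn n)) -e -p_m.
    by apply: eq_bigr => l _; rewrite addn0 binn mulr1n mulrC.
  have [|mu _ mu_m] := umbral_saturated HE (f := fun n => (m n)%:P%:P) _ [::].
    by rewrite m0.
  exists mu; first by exists m.
  move=> n nu nu_inj nu_mu; rewrite /umbral_eq (umbral_evalC HE) p_q.
  apply/esym/(umbral_eval_umbral_seq HE m0 nu_inj) => i lt_in l.
  exact: etrans (nu_mu i lt_in l) (mu_m l).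
have m0 := scalar_umbra_moment0 HE mu_m.
suff p_q : p =1 umbral_seq m.
  move=> n a b; rewrite p_q umbral_seq_binomial.
  by apply: eq_bigr => i _; rewrite !p_q.
(* The assumption on [mu] quantifies over all admissible [nu], so one must be produced to extract
   [p n] from it. *)
move=> n; have [nu [nu_inj nu_mu]] := exchangeable_umbrae HE mu n.
apply: (map_inj_poly (@polyC_inj k) (polyC0 k)).
rewrite -(umbral_evalC HE (p n)^:P) (p_mu n nu nu_inj nu_mu).
apply: (umbral_eval_umbral_seq HE m0 nu_inj) => i lt_in l.
exact: etrans (nu_mu i lt_in l) (mu_m l).
Qed.
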